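(* For any nonzero ring $R$ and any natural number $n\ge 2$, the full matrix ring ${\rm M}_n(R)$ is not a $W\sqrt{J}U$ ring.
   Context: Rings are associative with identity, not necessarily commutative. For a ring $A$, $U(A)$ is its group of units, $J(A)$ its Jacobson radical, and $\sqrt{J(A)}=\{x\in A : x^n\in J(A)\text{ for some } n\ge 1\}$. A ring $A$ is $W\sqrt{J}U$ (weakly $\sqrt{J}U$) if $U(A)=\pm 1+\sqrt{J(A)}$; equivalently, every unit of $A$ can be written as $j+1$ or as $j-1$ for some $j\in\sqrt{J(A)}$. *)

(* Defs.v *)
From mathcomp Require Import all_boot all_algebra.
From mathcomp Require Import boolp classical_sets.

Import GRing.Theory.

Local Open Scope classical_set_scope.
Local Open Scope ring_scope.

(* [GRing.unit] needs a [unitRingType]; matrices over a noncommutative ring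
   carry no such structure, so units are elements with a two-sided inverse. *)
Definition ring_units (A : pzRingType) : set A :=
  [set u | exists v : A, u * v = 1 /\ v * u = 1].

Definition left_ideal {A : pzRingType} (I : set A) : Prop :=
  [/\ I 0,
      forall x y : A, I x -> I y -> I (x - y)
    & forall a x : A, I x -> I (a * x)].

Definition maximal_left_ideal {A : pzRingType} (M : set A) : Prop :=
  [/\ left_ideal M,
      M <> setT
    & forall I : set A, left_ideal I -> M `<=` I -> I = M \/ I = setT].

Definition jacobson_radical (A : pzRingType) : set A :=
  [set x | forall M : set A, maximal_left_ideal M -> M x].

Definition sqrt_jacobson (A : pzRingType) : set A :=
  [set x | exists2 n : nat, (0 < n)%N & jacobson_radical A (x ^+ n)].

Definition WsqrtJU (A : pzRingType) : Prop :=
  ring_units A =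
    [set 1 + j | j in sqrt_jacobson A] `|` [set - 1 + j | j in sqrt_jacobson A].

(* Main.v *)
Require Import Defs.
From mathcomp Require Import all_boot all_algebra.
From mathcomp Require Import boolp classical_sets.

(** The reason is that M_n(R), for n >= 2, contains an element c all three of
    whose translates c, c - 1 and c + 1 are units.  In a nonzero ring no power
    of a unit lies in the Jacobson radical, so neither c - 1 nor c + 1 belongs
    to the set of elements with a power in the radical, and the unit c cannot
    be written as 1 + j or as - 1 + j with j in that set.

    Any c with c ^ n = c + 1 will do ([trinomial_units]): the relation reads
    c * (c ^ (n - 1) - 1) = 1, which makes c a unit together with every factor
    of c ^ (n - 1) - 1, such as c - 1, while c + 1 is a power of c.  Such a
    matrix exists over the integers, namely the companion matrix of the
    polynomial X ^ n - X - 1, by the Cayley-Hamilton theorem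
    ([exists_trinomial_matrix_int]).  Since Z maps to every ring, commutative or
    not, the matrix can be transported to M_n(R).

    That the Jacobson radical misses the units amounts to the existence of a
    maximal left ideal in a nonzero ring ([exists_maximal_left_ideal]), which
    is an application of Zorn's lemma. *)

Import GRing.Theory.

Local Open Scope classical_set_scope.
Local Open Scope ring_scope.

Lemma left_ideal_unit (A : pzRingType) (I : set A) (u : A) :
  left_ideal I -> ring_units A u -> I u -> I = setT.
Proof.
move=> [_ _ Imul] [v [_ vu]] Iu; apply/seteqP; split=> // x _.
by have := Imul (x * v) _ Iu; rewrite -mulrA vu mulr1.
Qed.

Lemma exists_maximal_left_ideal (A : pzRingType) :
  (1 : A) <> 0 -> exists M : set A, maximal_left_ideal M.
Proof.
move=> one_neq0.
(* Membership of 0 is left out so that the union of the empty chain, which is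
   the empty set, qualifies as well. *)
pose proper_ideal (X : set A) :=
  [/\ forall x y, X x -> X y -> X (x - y),
      forall a x, X x -> X (a * x)
    & ~ X 1].
have [|M [[Msub Mmul M1] Mmax]] := @Zorn_bigcup A proper_ideal.
  move=> F Fideal Fchain; split.
  - move=> x y [X FX Xx] [Y FY Yy].
    have [XY|YX] := Fchain _ _ FX FY.
      by exists Y => //; have [Ysub _ _] := Fideal _ FY; apply: Ysub => //;
        apply: XY.
    by exists X => //; have [Xsub _ _] := Fideal _ FX; apply: Xsub => //;
      apply: YX.
  - by move=> a x [X FX Xx]; exists X => //; have [_ + _] := Fideal _ FX; apply.
  - by move=> [X FX X1]; have [_ _] := Fideal _ FX.
(* Maximality rules out the empty set, because {0} is larger. *)
have M0 : M 0.
  apply: contrapT => notM0; apply: (Mmax [set 0]).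
    split; last by move=> sub0M; apply: notM0; apply: sub0M.
    by move=> x Mx; case: notM0; rewrite -(subrr x); apply: Msub.
  by split=> [x y /= -> ->|a x /= ->|/one_neq0 //]; rewrite ?subr0 ?mulr0.
exists M; split=> //; first by move=> MT; apply: M1; rewrite MT.
move=> I Iideal MI; have [I1|notI1] := pselect (I 1).
  by right; apply: left_ideal_unit I1 => //; exists 1; rewrite mulr1.
left; apply: contrapT => neqIM; apply: (Mmax I).
  by split=> // IM; apply: neqIM; apply/seteqP.
by case: Iideal => _ Isub Imul; split.
Qed.

Lemma ring_unitsX (A : pzRingType) (u : A) (k : nat) :
  ring_units A u -> ring_units A (u ^+ k).
Proof.
move=> [v [uv vu]]; exists (v ^+ k).
by rewrite -!exprMn_comm ?uv ?vu ?expr1n // /GRing.comm uv vu.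
Qed.

(** A left ideal containing a power of a unit is the whole ring, whereas the
    Jacobson radical lies in some maximal, hence proper, left ideal. *)
Lemma ring_units_not_sqrt_jacobson (A : pzRingType) (u : A) :
  (1 : A) <> 0 -> ring_units A u -> ~ sqrt_jacobson A u.
Proof.
move=> one_neq0 u_unit [k _ Juk].
have [M M_max] := @exists_maximal_left_ideal A one_neq0.
have [M_ideal M_proper _] := M_max.
by apply: M_proper; apply: (left_ideal_unit _ _ (u ^+ k)) => //;
  [exact: ring_unitsX | exact: Juk].
Qed.

Lemma not_WsqrtJU_of_units (A : pzRingType) (c : A) :
  (1 : A) <> 0 ->
  ring_units A c -> ring_units A (c - 1) -> ring_units A (c + 1) ->
  ~ WsqrtJU A.
Proof.
move=> one_neq0 c_unit cB1_unit cD1_unit AW.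
move: c_unit; rewrite AW => -[] [j Jj cE].
- by apply: ring_units_not_sqrt_jacobson Jj; rewrite // -[j](addKr 1) cE addrC.
- apply: ring_units_not_sqrt_jacobson Jj; rewrite //.
  by rewrite -[j](addKr (- 1)) cE opprK addrC.
Qed.

Lemma ring_units_factor (A : pzRingType) (x y : A) :
  GRing.comm x y -> ring_units A (x * y) -> ring_units A x.
Proof.
move=> xy [w [xyw wxy]]; exists (y * w); split; first by rewrite mulrA.
(* A left and a right inverse of x coincide. *)
have wyx : w * y * x = 1 by rewrite -mulrA -xy.
suff -> : y * w = w * y by [].
by rewrite -[y * w]mul1r -wyx -!mulrA [x * (y * w)]mulrA xyw mulr1.
Qed.

(** With n = m + 1, the relation is c * (c ^ m - 1) = 1, and c - 1 divides
    c ^ m - 1. *)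
Lemma trinomial_units (A : pzRingType) (c : A) (n : nat) :
  (0 < n)%N -> c ^+ n = c + 1 ->
  [/\ ring_units A c, ring_units A (c - 1) & ring_units A (c + 1)].
Proof.
case: n => // m _ cE.
have inv : c * (c ^+ m - 1) = 1.
  by rewrite mulrBr mulr1 -exprS cE addrC addKr.
have comm : GRing.comm c (c ^+ m - 1).
  by apply: commrB; [apply: commrX | apply: commr1].
have unit1 : ring_units A 1 by exists 1; rewrite mulr1.
have c_unit : ring_units A c.
  by apply: (ring_units_factor _ _ _ comm); rewrite inv.
split=> //; last by rewrite -cE; apply: ring_unitsX.
apply: (ring_units_factor _ _ (\sum_(i < m) c ^+ i)).
  apply: commr_sum => i _; apply: commrX; apply: commr_sym.
  by apply: commrB; [|apply: commr1].
rewrite -subrX1; apply: (ring_units_factor _ _ c); first exact: commr_sym.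
by rewrite -comm inv.
Qed.

(** Fixing the dimension beforehand avoids carrying matrices whose size is the
    expression (size p).-1. *)
Lemma exists_char_poly (R : comNzRingType) (p : {poly R}) (n : nat) :
  p \is monic -> size p = n.+1 -> exists C : 'M[R]_n, char_poly C = p.
Proof.
move=> p_monic p_size.
have : exists C : 'M[R]_((size p).-1), char_poly C = p.
  by exists (companionmx p); apply: companionmxK.
by rewrite p_size.
Qed.

Lemma exists_trinomial_matrix_int (m : nat) :
  exists C : 'M[int]_m.+2, C ^+ m.+2 = C + 1.
Proof.
pose p : {poly int} := 'X^(m.+2) - ('X + 1).
have low_size : (size (- ('X + 1) : {poly int}) < size ('X^(m.+2) : {poly int}))%N.
  by rewrite size_polyN size_polyXn -polyC1 size_XaddC.
have p_size : size p = m.+3 by rewrite size_polyDl // size_polyXn.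
have p_monic : p \is monic by rewrite monicE lead_coefDl // lead_coefXn.
have [C CE] := @exists_char_poly _ p _ p_monic p_size.
exists C; apply/eqP; rewrite -subr_eq0; apply/eqP.
have := Cayley_Hamilton C; rewrite CE rmorphB rmorphD rmorphXn /=.
by rewrite horner_mx_X rmorph1.
Qed.

(** Cayley-Hamilton requires commutative entries, so the matrix over R is
    obtained as the image of an integer one. *)
Lemma exists_trinomial_matrix (R : nzRingType) (m : nat) :
  exists C : 'M[R]_m.+2, C ^+ m.+2 = C + 1.
Proof.
have [C CE] := exists_trinomial_matrix_int m.
exists (map_mx intr C).
by rewrite -rmorphXn CE rmorphD rmorph1.
Qed.

Theorem proposition2p11 (R : nzRingType) (n : nat) (n_ge2 : (2 <= n)%N) :
  ~ WsqrtJU 'M[R]_n.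
Proof.
case: n n_ge2 => [|[|m]] // _.
have [C CE] := exists_trinomial_matrix R m.
have [C_unit CB1_unit CD1_unit] := trinomial_units _ _ m.+2 isT CE.
by apply: (not_WsqrtJU_of_units _ C) => //; apply/eqP; exact: oner_neq0.
Qed.
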